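(* Suppose that a real Banach space $X$ has the Daugavet property and that $Y\subset X$ is a closed subspace whose annihilator $Y^\perp=\{x^*\in X^*: x^*|_Y=0\}$ is (norm) separable. Then $Y$ has the Daugavet property.
   Context: A Banach space $X$ has the Daugavet property if $\|\mathrm{Id}+T\|=1+\|T\|$ for every bounded linear operator $T\colon X\to X$ of rank $1$. *)

(* Defs.v *)
From HB Require Import structures.
From mathcomp Require Import all_boot all_order all_algebra.
From mathcomp Require Import all_classical all_reals all_analysis.

Set Implicit Arguments.
Unset Strict Implicit.
Unset Printing Implicit Defensive.

Import Order.TTheory GRing.Theory Num.Theory.
Import numFieldNormedType.Exports.

Local Open Scope classical_set_scope.
Local Open Scope ring_scope.

Section BoundedOperators.
Context {R : realType} (X Y : normedModType R).

Definition bounded_linear : {pred (X -> Y)} :=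
  [pred f : X -> Y | `[< linear f /\ bounded_fun_norm f >]].

Lemma bounded_linearP (f : X -> Y) :
  reflect (linear f /\ bounded_fun_norm f) (f \in bounded_linear).
Proof. exact: asboolP. Qed.

Lemma bounded_linear_submod_closed : submod_closed bounded_linear.
Proof.
split.
  apply/bounded_linearP; split=> [a u v|r]; first by rewrite scaler0 addr0.
  by exists 0 => x _; rewrite normr0.
move=> a f g /bounded_linearP[lf bf] /bounded_linearP[lg bg].
apply/bounded_linearP; split=> [b u v|r].
  change (a *: f (b *: u + v) + g (b *: u + v) =
    b *: (a *: f u + g u) + (a *: f v + g v)).
  by rewrite lf lg !scalerDr !scalerA mulrC addrACA.
have [M fM] := bf r; have [N gN] := bg r.
exists (`|a| * M + N) => x xr; apply: le_trans (ler_normD _ _) _.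
by rewrite lerD ?gN// normrZ ler_wpM2l ?fM.
Qed.

HB.instance Definition _ := GRing.isSubmodClosed.Build R (X -> Y)
  bounded_linear bounded_linear_submod_closed.

Record boundedOperator := BoundedOperator {
  bop_fun :> X -> Y;
  bop_funP : bop_fun \in bounded_linear }.

HB.instance Definition _ := [isSub for bop_fun].
HB.instance Definition _ := [Choice of boundedOperator by <:].
HB.instance Definition _ := [SubChoice_isSubLmodule of boundedOperator by <:].

Definition opnorm (T : boundedOperator) : R :=
  sup [set `|T x| | x in [set x : X | `|x| <= 1]].

Lemma opnorm_has_sup (T : boundedOperator) :
  has_sup [set `|T x| | x in [set x : X | `|x| <= 1]].
Proof.
split; first by exists `|T 0|, 0 => //=; rewrite normr0.
have /bounded_linearP[_ /(_ 1)[M TM]] := bop_funP T.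
by exists M => _ [x x1 <-]; exact: TM.
Qed.

Lemma opnorm_unit_ball (T : boundedOperator) x : `|x| <= 1 -> `|T x| <= opnorm T.
Proof.
by move=> x1; apply: ub_le_sup; [exact: (opnorm_has_sup T).2|exists x].
Qed.

Lemma opnorm_le (T : boundedOperator) M :
  (forall x, `|x| <= 1 -> `|T x| <= M) -> opnorm T <= M.
Proof.
move=> TM; apply: ge_sup; first exact: (opnorm_has_sup T).1.
by move=> _ [x x1 <-]; exact: TM.
Qed.

Lemma ler_opnormD (S T : boundedOperator) :
  opnorm (S + T) <= opnorm S + opnorm T.
Proof.
apply: opnorm_le => x x1; apply: le_trans (ler_normD _ _) _.
by rewrite lerD// opnorm_unit_ball.
Qed.

Lemma opnormZ (a : R) (T : boundedOperator) :
  opnorm (a *: T) = `|a| * opnorm T.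
Proof.
have aT b S : opnorm (b *: S) <= `|b| * opnorm S.
  apply: opnorm_le => x x1; change (`|b *: S x| <= `|b| * opnorm S).
  by rewrite normrZ ler_wpM2l// opnorm_unit_ball.
apply/eqP; rewrite eq_le aT/=; have [->|a0] := eqVneq a 0.
  rewrite normr0 mul0r; apply: le_trans (opnorm_unit_ball _ (x := 0) _) => //.
  by rewrite normr0.
rewrite -ler_pdivlMl ?normr_gt0// -normfV.
by rewrite -[X in opnorm X <= _](scalerK a0) aT.
Qed.

Lemma opnorm0_eq0 (T : boundedOperator) : opnorm T = 0 -> T = 0.
Proof.
move=> T0; apply/val_inj/funext => x /=; change (T x = 0).
have /bounded_linearP[lT _] := bop_funP T.
have TZ a u : T (a *: u) = a *: T u.
  have T00 : T 0 = 0 by have := lT (-1) 0 0; rewrite !scaleN1r oppr0 addr0 addNr.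
  by have := lT a u 0; rewrite !addr0 T00 addr0.
have [->|x0] := eqVneq x 0; first by rewrite -(scale0r 0) TZ scale0r.
have := opnorm_unit_ball T (x := `|x|^-1 *: x).
rewrite normrZ normfV normr_id mulVf ?normr_eq0// => /(_ (lexx _)).
rewrite T0 TZ normr_le0 scaler_eq0 invr_eq0 normr_eq0 (negbTE x0)/=.
by move/eqP.
Qed.

HB.instance Definition _ := @Lmodule_isNormed.Build R boundedOperator
  opnorm ler_opnormD opnormZ opnorm0_eq0.

End BoundedOperators.

Section DaugavetProperty.
Context {R : realType} (X : normedModType R).

Lemma id_bounded_linear : (idfun : X -> X) \in @bounded_linear R X X.
Proof. by apply/bounded_linearP; split=> // r; exists r. Qed.

Definition id_op : boundedOperator X X := BoundedOperator id_bounded_linear.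

Definition rank_one (T : boundedOperator X X) :=
  exists2 v : X, v != 0 & range T = [set a *: v | a in [set: R]].

Definition Daugavet_property :=
  forall T : boundedOperator X X, rank_one T -> `|id_op + T| = 1 + `|T|.

End DaugavetProperty.

Section Subspace.
Context {R : realType} {X : normedModType R} (Y : submodClosed X).

(* An alias of the sigma type, which carries the topology of a subtype; here
   the topology is generated by the restriction of the norm of X. *)
Definition subspace_type := {x : X | x \in Y}.

HB.instance Definition _ := SubChoice.on subspace_type.
HB.instance Definition _ := [SubChoice_isSubLmodule of subspace_type by <:].

Definition subspace_norm (y : subspace_type) : R := `|val y|.

Lemma ler_subspace_normD (y z : subspace_type) :
  subspace_norm (y + z) <= subspace_norm y + subspace_norm z.
Proof. exact: ler_normD. Qed.

Lemma subspace_normZ (a : R) (y : subspace_type) :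
  subspace_norm (a *: y) = `|a| * subspace_norm y.
Proof. exact: normrZ. Qed.

Lemma subspace_norm0_eq0 (y : subspace_type) : subspace_norm y = 0 -> y = 0.
Proof. by move=> /normr0_eq0 y0; apply/val_inj. Qed.

HB.instance Definition _ := @Lmodule_isNormed.Build R subspace_type
  subspace_norm ler_subspace_normD subspace_normZ subspace_norm0_eq0.

End Subspace.

Definition dual {R : realType} (X : normedModType R) : normedModType R :=
  boundedOperator X R^o.

Definition annihilator {R : realType} {X : normedModType R} (Y : {pred X}) :
    set (dual X) :=
  [set f : boundedOperator X R^o | forall y, y \in Y -> f y = 0].

Definition separable_set {T : topologicalType} (S : set T) :=
  exists D : set T, [/\ countable D, D `<=` S & S `<=` closure D].

(* Main.v *)
Require Import Defs.
From mathcomp Require Import all_boot all_order all_algebra.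
From mathcomp Require Import all_classical all_reals all_analysis.
From mathcomp Require Import lra.
Import Order.TTheory GRing.Theory Num.Theory.
Import numFieldNormedType.Exports.
Local Open Scope classical_set_scope.
Local Open Scope ring_scope.

Set Implicit Arguments.
Unset Strict Implicit.
Unset Printing Implicit Defensive.

(** Rank-one operators have the form z |-> e z *: v, and after normalising v
the Daugavet property says ([Daugavet_propertyP]): for every nonzero functional
e and every unit vector v, some x in the unit ball makes the norm of
x + e x *: v almost as large as 1 + |e|.

Read in the dual, such an x yields a whole weak* slice.  A functional f of norm at
most 1 which almost attains 1 + |e| at x + e x *: v must have f v close to 1,
so it lies in any prescribed slice around v, and e x + f x close to |e| + 1,
so that |e + f| is almost |e| + 1.  Hence every slice of the dual ball contains
a smaller one all of whose elements f satisfy |e + f| >= |e| + 1 - d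
([Daugavet_subslice]).  Iterating over a sequence of functionals e n gives
nested slices, which have a common point by weak* compactness, so a single g in
the initial slice serves all the e n ([Daugavet_slice_sequence]).

Now let e be a functional on Y and v a unit vector of Y.  Extend e to x on the
ambient space with the same norm, and take for e n the translates x + u n,
where u is dense in the annihilator of Y; each has norm at least |e| because it
still restricts to e.  This gives g in the slice at v with
|x + f + g| >= |e| + 1 - 2 r for every f in the annihilator.  The least such
norm is the norm of the restriction of x + g to Y ([restriction_norm_ge]), so
x + g almost attains |e| + 1 at some z in the unit ball of Y.  There e z is
almost |e| and g z almost 1, and g v is almost 1, so applying g to z + e z *: v
shows that its norm is almost 1 + |e|.

Norm-preserving extension, norming functionals and the common point of nested
slices are all obtained from one separation principle, the Mazur-Orlicz theorem
([Mazur_Orlicz]).  It is proved with functions defined on the whole space, by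
taking a minimal sublinear function, instead of with partially defined
extensions. *)

(** * Sublinear functions and the Mazur-Orlicz theorem *)

Definition sublinear {R : realType} {X : lmodType R} (p : X -> R) :=
  (forall x y, p (x + y) <= p x + p y) /\
  (forall t x, 0 < t -> p (t *: x) <= t * p x).

Lemma sublinearZ (R : realType) (X : lmodType R) (p : X -> R) t x :
  sublinear p -> 0 < t -> p (t *: x) = t * p x.
Proof.
move=> [_ pZ] t0; apply/eqP; rewrite eq_le pZ//= -ler_pdivlMl//.
by rewrite -[in leLHS](scalerK (lt0r_neq0 t0) x) pZ// invr_gt0.
Qed.

Lemma sublinear0 (R : realType) (X : lmodType R) (p : X -> R) :
  sublinear p -> p 0 = 0.
Proof.
move=> sp; have := sublinearZ 0 sp (ltr0Sn R 1).
by rewrite scaler0 => p0; lra.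
Qed.

Lemma sublinearN (R : realType) (X : lmodType R) (p : X -> R) x :
  sublinear p -> - p (- x) <= p x.
Proof.
by move=> sp; have := sp.1 x (- x); rewrite subrr sublinear0// => ?; lra.
Qed.

(** The bounds E x stay as sets, one for each x, because the infimum is taken
once over a chain of functions and once over a cone; both only require that
members of E x and E y add up to something above a member of E (x + y). *)
Lemma inf_sublinear (R : realType) (X : lmodType R) (E : X -> set R) :
  (forall x, has_inf (E x)) ->
  (forall x y a b, E x a -> E y b -> exists2 c, E (x + y) c & c <= a + b) ->
  (forall t x a, 0 < t -> E x a -> exists2 c, E (t *: x) c & c <= t * a) ->
  sublinear (fun x => inf (E x)).
Proof.
move=> Einf ED EZ; split=> [x y|t x t0].
  rewrite -lerBlDr; apply: lb_le_inf; first exact: (Einf x).1.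
  move=> a Ea; rewrite lerBlDr -lerBlDl; apply: lb_le_inf.
    exact: (Einf y).1.
  move=> b Eb; rewrite lerBlDl; have [c Ec cab] := ED _ _ _ _ Ea Eb.
  by apply: le_trans cab; apply: ge_inf => //; exact: (Einf _).2.
rewrite -ler_pdivrMl//; apply: lb_le_inf; first exact: (Einf x).1.
move=> a Ea; rewrite ler_pdivrMl//; have [c Ec cta] := EZ _ _ _ t0 Ea.
by apply: le_trans cta; apply: ge_inf => //; exact: (Einf _).2.
Qed.

(** A pair (c, r) stands for the demand r <= g c on a functional g.  Pairs,
rather than a function on a cone of X, let several demands bear on the same
vector. *)
Definition convex_cone {R : realType} {X : lmodType R} (K : set (X * R)) :=
  [/\ K (0, 0),
      forall u v, K u -> K v -> K (u.1 + v.1, u.2 + v.2) &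
      forall t u, 0 < t -> K u -> K (t *: u.1, t * u.2)].

(** The function q x = inf over (c, r) in K of p (x + c) - r: at x = - c the
choice (c, r) itself yields - r, and the demands being compatible with p bounds
the infimum below by - p (- x). *)
Lemma sublinear_cone (R : realType) (X : lmodType R) (p : X -> R)
    (K : set (X * R)) :
  sublinear p -> convex_cone K -> (forall u, K u -> u.2 <= p u.1) ->
  exists q, [/\ sublinear q, forall x, q x <= p x &
    forall u, K u -> q (- u.1) <= - u.2].
Proof.
move=> sp [K0 KD KZ] Kp.
pose E x := [set p (x + u.1) - u.2 | u in K].
have Einf x : has_inf (E x).
  split; first by exists (p (x + 0) - 0), (0, 0).
  exists (- p (- x)) => _ [u Ku <-].
  have := sp.1 (x + u.1) (- x); rewrite addrAC subrr add0r => ?.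
  by have := Kp _ Ku => ?; lra.
have qE x u : K u -> inf (E x) <= p (x + u.1) - u.2.
  by move=> Ku; apply: ge_inf; [exact: (Einf x).2|exists u].
exists (fun x => inf (E x)); split.
- apply: inf_sublinear => // [x y _ _ [u Ku <-] [v Kv <-]|t x _ t0 [u Ku <-]].
    exists (p (x + y + (u.1 + v.1)) - (u.2 + v.2)).
      by exists (u.1 + v.1, u.2 + v.2) => //; exact: KD.
    by rewrite addrACA; have := sp.1 (x + u.1) (y + v.1) => ?; lra.
  exists (p (t *: x + t *: u.1) - t * u.2).
    by exists (t *: u.1, t * u.2) => //; exact: KZ.
  by rewrite -scalerDr sublinearZ// mulrBr.
- by move=> x; have := qE x _ K0; rewrite addr0 subr0.
- by move=> u Ku; have := qE (- u.1) _ Ku; rewrite addNr sublinear0// sub0r.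
Qed.

(** Lowering p along the ray of y, with the demands t * p y on t *: y, cannot
produce anything smaller than p, whence p (- y) <= - p y: p is odd, and odd
subadditive functions are additive. *)
Lemma minimal_sublinear_linear (R : realType) (X : lmodType R) (p : X -> R) :
  sublinear p ->
  (forall q, sublinear q -> (forall x, q x <= p x) -> forall x, p x <= q x) ->
  linear (p : X -> R^o).
Proof.
move=> sp pmin.
have pN y : p (- y) = - p y.
  have [||q [sq qp qK]] :=
      @sublinear_cone R X p
        [set u | exists2 t, 0 <= t & u = (t *: y, t * p y)] sp.
  - split; first by exists 0; rewrite // scale0r mul0r.
      move=> _ _ [s s0 ->] [t t0 ->] /=; exists (s + t); first exact: addr_ge0.
      by rewrite scalerDl mulrDl.
    move=> s _ s0 [t t0 ->] /=; exists (s * t).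
      by rewrite mulr_ge0// ltW.
    by rewrite scalerA mulrA.
  - move=> _ [t t0 ->] /=; move: t0; rewrite le_eqVlt => /predU1P[<-|t0].
      by rewrite scale0r mul0r sublinear0.
    by rewrite sublinearZ.
  apply/eqP; rewrite eq_le; apply/andP; split.
    apply: le_trans (pmin _ sq qp _) _.
    by have := qK (y, p y); apply; exists 1; rewrite // scale1r mul1r.
  by have := sublinearN (- y) sp; rewrite opprK => ?; lra.
have pD x y : p (x + y) = p x + p y.
  apply/eqP; rewrite eq_le sp.1/=.
  by have := sp.1 (x + y) (- y); rewrite addrK pN => ?; lra.
have pZ t x : p (t *: x) = t * p x.
  have [t0|t0|->] := ltgtP t 0; last by rewrite scale0r mul0r sublinear0.
    by rewrite -[t]opprK scaleNr pN sublinearZ ?oppr_gt0// -mulNr.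
  exact: sublinearZ.
by move=> a x y; rewrite pD pZ.
Qed.

(** Zorn's lemma: a chain of sublinear functions below p has its pointwise
infimum as a lower bound, the values at x being at least - p (- x). *)
Lemma exists_linear_below (R : realType) (X : lmodType R) (p : X -> R) :
  sublinear p ->
  exists2 g : X -> R^o, linear g & forall x, g x <= p x.
Proof.
move=> sp.
pose T := {q : X -> R | sublinear q /\ forall x, q x <= p x}.
pose below (s t : T) := `[< forall x, sval t x <= sval s x >].
have [||A Atot|[g [sg gp]] gmin] := @ZL_preorder T (exist _ p (conj sp (fun=> lexx _))) below.
- by move=> t; apply/asboolP.
- move=> r s t /asboolP rs /asboolP st; apply/asboolP => x.
  exact: le_trans (st x) (rs x).
- have [->|/set0P[a Aa]] := eqVneq A set0.
    by exists (exist _ p (conj sp (fun=> lexx _))).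
  pose E x := [set sval s x | s in A].
  have Einf x : has_inf (E x).
    split; first by exists (sval a x), a.
    exists (- p (- x)) => _ [s As <-]; have [ss sp'] := svalP s.
    by apply: le_trans (sublinearN x ss); rewrite lerN2.
  have infE x s : A s -> inf (E x) <= sval s x.
    by move=> As; apply: ge_inf; [exact: (Einf x).2|exists s].
  have sinf : sublinear (fun x => inf (E x)).
    apply: inf_sublinear => // [x y _ _ [s As <-] [t At <-]|t x _ t0 [s As <-]].
      have [/asboolP st|/asboolP ts] := Atot _ _ As At.
        exists (sval t (x + y)); first by exists t.
        by apply: le_trans ((svalP t).1.1 x y) _; rewrite lerD2r.
      exists (sval s (x + y)); first by exists s.
      by apply: le_trans ((svalP s).1.1 x y) _; rewrite lerD2l.
    exists (sval s (t *: x)); first by exists s.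
    exact: (svalP s).1.2.
  have infp x : inf (E x) <= p x by apply: le_trans (infE x a Aa) ((svalP a).2 x).
  pose t : T := exist (fun q => sublinear q /\ forall x, q x <= p x)
    (fun x => inf (E x)) (conj sinf infp).
  by exists t => s As; apply/asboolP => x; exact: infE.
exists g => //; apply: minimal_sublinear_linear => // q sq qg.
have qp x : q x <= p x by exact: le_trans (qg x) (gp x).
by have /asboolP := gmin (exist _ q (conj sq qp)) (asboolT qg).
Qed.

(** A linear functional below the function of [sublinear_cone] satisfies
g (- c) <= - r, which is the demand r <= g c. *)
Lemma Mazur_Orlicz (R : realType) (X : lmodType R) (p : X -> R)
    (K : set (X * R)) :
  sublinear p -> convex_cone K -> (forall u, K u -> u.2 <= p u.1) ->
  exists g : X -> R^o, [/\ linear g, forall x, g x <= p x &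
    forall u, K u -> u.2 <= g u.1].
Proof.
move=> sp cK Kp; have [q [sq qp qK]] := sublinear_cone sp cK Kp.
have [g lg gq] := exists_linear_below sq.
exists g; split=> // [x|u Ku]; first exact: le_trans (gq x) (qp x).
have g0 : g 0 = 0 by have := lg (-1) 0 0; rewrite !scaleN1r oppr0 addr0 addNr.
have gN : g (- u.1) = - g u.1.
  by have := lg (-1) u.1 0; rewrite !scaleN1r g0 !addr0.
by have := le_trans (gq _) (qK _ Ku); rewrite gN lerN2.
Qed.

(** * Bounded operators *)

Section BoundedOperatorTheory.
Context {R : realType} {X Y : normedModType R}.
Implicit Types (T : boundedOperator X Y).

Lemma bop_linear T : linear T.
Proof. by have /bounded_linearP[] := bop_funP T. Qed.

Lemma bop0 T : T 0 = 0.
Proof.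
by have := bop_linear T (-1) 0 0; rewrite !scaleN1r oppr0 addr0 addNr.
Qed.

Lemma bopZ T a x : T (a *: x) = a *: T x.
Proof. by have := bop_linear T a x 0; rewrite !addr0 bop0 addr0. Qed.

Lemma bopD T x y : T (x + y) = T x + T y.
Proof. by have := bop_linear T 1 x y; rewrite !scale1r. Qed.

Lemma bopN T x : T (- x) = - T x.
Proof. by rewrite -scaleN1r bopZ scaleN1r. Qed.

Lemma bop_le T x : `|T x| <= `|T| * `|x|.
Proof.
have [->|x0] := eqVneq x 0; first by rewrite bop0 !normr0 mulr0.
have x_gt0 : 0 < `|x| by rewrite normr_gt0.
rewrite -ler_pdivrMr// mulrC -(gtr0_norm x_gt0) -normfV -normrZ -bopZ.
apply: opnorm_unit_ball.
by rewrite normrZ normfV normr_id mulVf// gt_eqF.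
Qed.

Lemma exists_bop (f : X -> Y) (M : R) : linear f -> 0 <= M ->
  (forall x, `|f x| <= M * `|x|) ->
  exists2 T : boundedOperator X Y, T = f :> (X -> Y) & `|T| <= M.
Proof.
move=> lf M0 fM.
have bf : f \in @bounded_linear R X Y.
  apply/bounded_linearP; split=> // r; exists (M * r) => x xr.
  by apply: le_trans (fM x) _; rewrite ler_wpM2l.
exists (BoundedOperator bf) => //; apply: opnorm_le => x x1 /=.
by apply: le_trans (fM x) _; rewrite ler_piMr.
Qed.

Lemma lt_opnorm_ex T (c : R) : c < `|T| ->
  exists2 x, `|x| <= 1 & c < `|T x|.
Proof.
move=> cT; apply: contrapT => noex.
have : `|T| <= c.
  apply: opnorm_le => x x1; rewrite leNgt; apply/negP => cx.
  by apply: noex; exists x.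
by rewrite leNgt cT.
Qed.

End BoundedOperatorTheory.

(** * Hahn-Banach consequences in normed spaces *)

Lemma functional_gt0_ex (R : realType) (X : normedModType R)
    (f : boundedOperator X R^o) (c : R) : c < `|f| ->
  exists2 x, `|x| <= 1 & c < f x.
Proof.
move=> /lt_opnorm_ex[x x1]; have [fx0 cx|fx0 cx] := ger0P (f x : R).
  by exists x.
by exists (- x); rewrite ?normrN// bopN.
Qed.

Lemma norm_sublinear (R : realType) (X : normedModType R) (M : R) :
  0 <= M -> sublinear (fun x : X => M * `|x|).
Proof.
move=> M0; split=> [x y|t x t0].
  by rewrite -mulrDr ler_wpM2l// ler_normD.
by rewrite normrZ (gtr0_norm t0) mulrCA.
Qed.

Lemma Mazur_Orlicz_norm (R : realType) (X : normedModType R) (M : R)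
    (K : set (X * R)) : 0 <= M -> convex_cone K ->
  (forall u, K u -> u.2 <= M * `|u.1|) ->
  exists2 g : boundedOperator X R^o, `|g| <= M &
    forall u, K u -> u.2 <= g u.1.
Proof.
move=> M0 cK KM.
have [g [lg gM Kg]] := Mazur_Orlicz (norm_sublinear X M0) cK KM.
have gN x : g (- x) = - g x.
  have := lg (-1) x 0; have := lg (-1) 0 0.
  by rewrite !scaleN1r oppr0 !addr0 addNr => ->; rewrite addr0.
have [|f fg fM] := exists_bop lg M0.
  move=> x; rewrite ler_norml gM andbT lerNl -gN.
  by apply: le_trans (gM _) _; rewrite normrN.
by exists f => // u /Kg; rewrite fg.
Qed.

(** The cone is the graph of f; as Y is symmetric, the demands f y <= g y are
equalities. *)
Lemma Hahn_Banach_norm (R : realType) (X : normedModType R)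
    (Y : submodClosed X) (f : boundedOperator (subspace_type Y) R^o) :
  exists2 g : boundedOperator X R^o, `|g| <= `|f| &
    forall y : subspace_type Y, g (val y) = f y.
Proof.
have [| |_ [y ->] /=|g gf fg] :=
  @Mazur_Orlicz_norm R X `|f| [set u | exists y, u = (val y, f y)].
- exact: normr_ge0.
- split; first by exists 0; rewrite bop0.
    by move=> _ _ [x ->] [y ->]; exists (x + y); rewrite bopD.
  by move=> t _ t0 [x ->]; exists (t *: x); rewrite bopZ.
- exact: le_trans (ler_norm _) (bop_le f y).
exists g => // y; apply/eqP; rewrite eq_le.
have := fg (val (- y), f (- y)) (ex_intro _ _ erefl).
have := fg (val y, f y) (ex_intro _ _ erefl).
by rewrite /= !bopN lerN2 => -> ->.
Qed.

Lemma norming_functional (R : realType) (X : normedModType R) (w : X) :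
  exists2 f : boundedOperator X R^o, `|f| <= 1 & `|w| <= f w.
Proof.
have [| |_ [t t0 ->] /=|f f1 fw] := @Mazur_Orlicz_norm R X 1
  [set u | exists2 t, 0 <= t & u = (t *: w, t * `|w|)].
- exact: ler01.
- split; first by exists 0; rewrite // scale0r mul0r.
    move=> _ _ [s s0 ->] [t t0 ->] /=; exists (s + t); first exact: addr_ge0.
    by rewrite scalerDl mulrDl.
  move=> s _ s0 [t t0 ->] /=; exists (s * t); first by rewrite mulr_ge0// ltW.
  by rewrite scalerA mulrA.
- by rewrite normrZ ger0_norm// mul1r.
exists f => //; apply: (fw (w, `|w|)).
by exists 1; rewrite // scale1r mul1r.
Qed.

(** * The Daugavet property in terms of functionals *)

(** The vector spanning the range is rescaled to norm 1, so that the operator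
and its coefficient functional have the same norm. *)
Lemma rank_one_functional (R : realType) (Z : normedModType R)
    (T : boundedOperator Z Z) : rank_one T ->
  exists v (e : boundedOperator Z R^o),
    [/\ `|v| = 1, 0 < `|e|, forall z, T z = e z *: v & `|T| <= `|e|].
Proof.
move=> [w w0 rT].
have w_gt0 : 0 < `|w| by rewrite normr_gt0.
pose v := `|w|^-1 *: w.
have v1 : `|v| = 1 by rewrite normrZ normfV normr_id mulVf// gt_eqF.
have wv : w = `|w| *: v by rewrite scalerA divff ?gt_eqF// scale1r.
have vinj (a b : R) : a *: v = b *: v -> a = b.
  move/eqP; rewrite -subr_eq0 -scalerBl scaler_eq0 subr_eq0.
  by rewrite -(normr_eq0 v) v1 oner_eq0 orbF => /eqP.
have /choice[e Te] z : exists a : R^o, T z = a *: v.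
  have : range T (T z) by exists z.
  by rewrite rT => -[a _ <-]; exists (a * `|w|); rewrite -scalerA -wv.
have le : linear e.
  move=> a x y; apply: vinj; rewrite -Te bop_linear !Te scalerA -scalerDl.
  by [].
have [|f fe fT] := exists_bop le (normr_ge0 T).
  by move=> z; have := bop_le T z; rewrite Te normrZ v1 mulr1.
have Tf z : T z = f z *: v by rewrite fe.
exists v, f; split=> //; last first.
  apply: opnorm_le => z z1; rewrite Tf normrZ v1 mulr1.
  exact: opnorm_unit_ball.
rewrite normr_gt0; apply/eqP => f0.
have : range T w by rewrite rT; exists 1; rewrite // scale1r.
move=> [z _]; rewrite Tf f0 => /esym wE; move: w0; rewrite wE.
by rewrite scale0r eqxx.
Qed.

Lemma exists_rank_one (R : realType) (Z : normedModType R)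
    (e : boundedOperator Z R^o) (v : Z) : e != 0 -> v != 0 ->
  exists T : boundedOperator Z Z, [/\ rank_one T,
    forall z, T z = e z *: v & `|T| = `|e| * `|v|].
Proof.
move=> e0 v0.
have lT : linear (fun z => (e z : R) *: v).
  by move=> a x y; rewrite bop_linear scalerDl scalerA.
have [||T TE Tev] := exists_bop lT (M := `|e| * `|v|).
- exact: mulr_ge0.
- by move=> z; rewrite normrZ mulrAC ler_wpM2r// bop_le.
have Tz z : T z = e z *: v by rewrite TE.
exists T; split=> //.
  exists v => //; apply/seteqP; split=> [_ [z _ <-]|_ [a _ <-]].
    by exists (e z).
  have [x ex] : exists x, e x != 0.
    apply: contrapT => noex; move/eqP: e0; apply; apply/val_inj/funext => x.
    by apply/eqP; apply/negPn/negP => ex; apply: noex; exists x.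
  exists ((a / e x) *: x) => //; rewrite Tz bopZ.
  by congr (_ *: _); rewrite /GRing.scale/= mulfVK.
apply/eqP; rewrite eq_le Tev/= -ler_pdivlMr ?normr_gt0//.
apply: opnorm_le => z z1; rewrite ler_pdivlMr ?normr_gt0//.
by rewrite -normrZ -Tz opnorm_unit_ball.
Qed.

(** Only the lower bound of the norm of id + T matters, the upper bound being
the triangle inequality, and a supremum over the unit ball is tested up to an
arbitrary d. *)
Lemma Daugavet_propertyP (R : realType) (Z : normedModType R) :
  Daugavet_property Z <->
  forall (e : boundedOperator Z R^o) (v : Z) (d : R),
    0 < `|e| -> `|v| = 1 -> 0 < d ->
    exists2 x, `|x| <= 1 & 1 + `|e| - d < `|x + e x *: v|.
Proof.
split=> [DZ e v d e0 v1 d0|H T /rank_one_functional[v [e [v1 e0 Te TE]]]].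
  have [||T [T1 Te TE]] := @exists_rank_one R Z e v.
  - by rewrite -normr_gt0.
  - by rewrite -normr_eq0 v1 oner_eq0.
  have [|x x1 xT] := @lt_opnorm_ex R Z Z (id_op Z + T) (1 + `|e| - d).
    by rewrite DZ// TE v1 mulr1 ltrBlDr ltrDl.
  by exists x => //; rewrite -Te.
apply/eqP; rewrite eq_le; apply/andP; split.
  by apply: le_trans (ler_normD _ _) _; rewrite lerD2r; exact: opnorm_le.
apply: (@le_trans _ _ (1 + `|e|)); first by rewrite lerD2l.
apply/ler_addgt0Pr => d d0; rewrite -lerBlDr.
have [x x1 xd] := H e v d e0 v1 d0.
apply: le_trans (ltW xd) _; rewrite -Te.
exact: (opnorm_unit_ball (id_op Z + T)).
Qed.

(** * Slices of the dual ball *)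

(** The closed weak* slice cut out of the dual ball by a vector and a level. *)
Definition dual_slice {R : realType} {X : normedModType R} (s : X * R) :
    set (boundedOperator X R^o) :=
  [set f : boundedOperator X R^o | `|f| <= 1 /\ s.2 <= f s.1].

(** The new slice is cut out by x + e x *: v, where v is the direction of s.1
and x is given by the Daugavet property for e and v.  If
f x + e x * f v >= 1 + |e| - r, then f x <= 1 forces e x * f v >= |e| - r, so
that f v is close to 1, while f v <= 1 gives e x + f x >= 1 + |e| - r.  Levels
are kept nonnegative so that the vector of a slice is never 0. *)
Lemma Daugavet_subslice (R : realType) (X : normedModType R) :
  Daugavet_property X ->
  forall (s : X * R) (e : boundedOperator X R^o) (d : R),
    0 <= s.2 < `|s.1| -> 0 < `|e| -> 0 < d ->
    exists s' : X * R, [/\ 0 <= s'.2 < `|s'.1|, dual_slice s' `<=` dual_slice s &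
      forall f, dual_slice s' f -> `|e| + 1 - d <= `|e + f| ].
Proof.
move=> /Daugavet_propertyP DX [w c] e d /= /andP[c0 cw] e0 d0.
have w_gt0 : 0 < `|w| := le_lt_trans c0 cw.
pose v := `|w|^-1 *: w.
have v1 : `|v| = 1 by rewrite normrZ normfV normr_id mulVf// gt_eqF.
have wv : w = `|w| *: v by rewrite scalerA divff ?gt_eqF// scale1r.
(* The three bounds on r serve, in this order, the estimate on `|e + f|, the
   sign of f v, and the inclusion into the given slice, which asks for
   f v >= c / `|w|. *)
pose r := Num.min d (Num.min (`|e| / 2) (`|e| * (1 - c / `|w|))).
have r0 : 0 < r.
  by rewrite !lt_min d0 divr_gt0//= mulr_gt0// subr_gt0 ltr_pdivrMr// mul1r.
have rd : r <= d by rewrite /r ge_min lexx.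
have re : r <= `|e| / 2 by rewrite /r !ge_min lexx orbT.
have rc : r <= `|e| * (1 - c / `|w|) by rewrite /r !ge_min lexx !orbT.
(* Replacing x by - x leaves `|x + e x *: v| unchanged. *)
have [x [x1 ex0 xr]] : exists x, [/\ `|x| <= 1, 0 <= (e x : R) &
    1 + `|e| - r < `|x + e x *: v|].
  have [x x1 xr] := DX e v r e0 v1 r0.
  have [ex0|ex0] := lerP 0 (e x : R); first by exists x.
  exists (- x); rewrite normrN bopN scaleNr -opprD normrN; split=> //.
  by rewrite oppr_ge0 ltW.
have exe : (e x : R) <= `|e|.
  by apply: le_trans (ler_norm _) (le_trans (bop_le e x) _); rewrite ler_piMr.
have key f : dual_slice (x + e x *: v, 1 + `|e| - r) f ->
    [/\ (f v : R) <= 1, (f x : R) <= 1 &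
        1 + `|e| - r <= (f x : R) + (e x : R) * (f v : R)].
  move=> [/= f1]; rewrite bopD bopZ => fr.
  have fle z : `|z| <= 1 -> (f z : R) <= 1.
    move=> z1; apply: le_trans (ler_norm _) (le_trans (bop_le f z) _).
    by rewrite mulr_ile1.
  by split; rewrite ?fle ?v1.
exists (x + e x *: v, 1 + `|e| - r); split=> [|f Sf|f Sf].
- by rewrite /= xr andbT; lra.
- have [fv fx fr] := key f Sf; split; first exact: Sf.1.
  rewrite [s in f s]wv bopZ /= -ler_pdivrMl// mulrC.
  have fv0 : 0 < (f v : R) by nra.
  rewrite -(ler_pM2l e0); nra.
- have [fv fx fr] := key f Sf.
  have : (e x : R) + (f x : R) <= `|e + f|.
    apply: le_trans (ler_norm _) _; exact: (opnorm_unit_ball (e + f)).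
  nra.
Qed.

(** Weak* compactness of the dual ball for a decreasing sequence, through
Mazur-Orlicz: ask of g every inequality r <= f u which holds for all f in one of
the slices.  These demands form a cone because the slices decrease, and each is
compatible with the norm because each slice contains a norming functional; the
inequality defining a slice is itself among them. *)
Lemma nested_slices (R : realType) (X : normedModType R) (s : nat -> X * R) :
  (forall n, (s n).2 <= `|(s n).1|) ->
  (forall n, dual_slice (s n.+1) `<=` dual_slice (s n)) ->
  exists g, forall n, dual_slice (s n) g.
Proof.
move=> sne snest.
have mono m n : (m <= n)%N -> dual_slice (s n) `<=` dual_slice (s m).
  elim: n => [|n IH]; first by rewrite leqn0 => /eqP->.
  by rewrite leq_eqVlt => /predU1P[->//|/IH]; exact: subset_trans (snest n).
have [| |u [k Ku]|g g1 gK] := @Mazur_Orlicz_norm R X 1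
  [set u | exists k, forall f, dual_slice (s k) f -> u.2 <= f u.1].
- exact: ler01.
- split; first by exists 0 => f _; rewrite bop0.
    move=> u v [k Ku] [l Lv]; exists (maxn k l) => f Sf /=.
    by rewrite bopD lerD// ?Ku ?Lv//; apply: mono Sf; rewrite ?leq_maxl ?leq_maxr.
  move=> t u t0 [k Ku]; exists k => f Sf /=.
  by rewrite bopZ ler_wpM2l ?Ku// ltW.
- have [f f1 fs] := norming_functional (s k).1.
  apply: le_trans (Ku f _) _; first by split=> //; exact: le_trans fs.
  apply: le_trans (ler_norm _) (le_trans (bop_le _ _) _).
  by rewrite ler_wpM2r.
exists g => n; split=> //; apply: gK; exists n => f; exact: proj2.
Qed.

(** Each e n takes one step in a decreasing sequence of slices starting at s, and
a common point of all of them keeps every estimate. *)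
Lemma Daugavet_slice_sequence (R : realType) (X : normedModType R) :
  Daugavet_property X ->
  forall (s : X * R) (e : nat -> boundedOperator X R^o) (d : R),
    0 <= s.2 < `|s.1| -> (forall n, 0 < `|e n|) -> 0 < d ->
    exists2 g, dual_slice s g & forall n, `|e n| + 1 - d <= `|e n + g|.
Proof.
move=> DX s e d s0 e0 d0.
pose slices := {s : X * R | 0 <= s.2 < `|s.1|}.
have /choice[F FP] (ns : nat * slices) : exists s' : slices,
    dual_slice (sval s') `<=` dual_slice (sval ns.2) /\
    forall f, dual_slice (sval s') f -> `|e ns.1| + 1 - d <= `|e ns.1 + f|.
  have [s' [s'0 ss' s'e]] := Daugavet_subslice DX (svalP ns.2) (e0 ns.1) d0.
  by exists (exist _ s' s'0).
pose S := fix S n : slices :=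
  if n is m.+1 then F (m, S m) else exist _ s s0.
have [|n|g gS] := @nested_slices R X (fun n => sval (S n)).
- by move=> n; have /andP[_ /ltW] := svalP (S n).
- exact: (FP (n, S n)).1.
exists g => [|n]; first exact: (gS 0%N).
exact: (FP (n, S n)).2 _ (gS n.+1).
Qed.

(** The norm of the restriction of h to Y is the distance from h to the
annihilator of Y: a norm-preserving extension k of the restriction differs from
h by an element of the annihilator, so that |k| is one of the norms |h + f|. *)
Lemma restriction_norm_ge (R : realType) (X : normedModType R)
    (Y : submodClosed X) (h : boundedOperator X R^o) (c : R) :
  (forall f, annihilator Y f -> c <= `|h + f|) ->
  forall d, d < c ->
  exists z : subspace_type Y, `|z| <= 1 /\ d < (h (val z) : R).
Proof.
move=> hc d dc.
have lh : linear (fun z : subspace_type Y => h (val z)).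
  by move=> a x y; rewrite -bop_linear.
have [||hY hYE _] := exists_bop lh (M := `|h|); first exact: normr_ge0.
  by move=> z; exact: bop_le h (val z).
have [k kh kE] := Hahn_Banach_norm hY.
have [|z z1 hz] := @functional_gt0_ex R (subspace_type Y) hY d.
  apply: lt_le_trans dc (le_trans _ kh).
  rewrite -[k](subrKC h); apply: hc => y yY.
  have := kE (Sub y yY); rewrite SubK hYE SubK => ky.
  by change (k y - h y = 0); rewrite ky subrr.
by exists z; split=> //; move: hz; rewrite hYE.
Qed.

(** * Subspaces with separable annihilator *)

Lemma separable_set_sequence (R : realType) (V : normedModType R)
    (A : set V) : separable_set A -> A !=set0 ->
  exists2 u : nat -> V, forall n, A (u n) &
    forall a d, A a -> 0 < d -> exists n, `|a - u n| < d.
Proof.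
move=> [D [cD DA AD]] [a0 Aa0].
have approx a d : A a -> 0 < d -> exists2 b, D b & `|a - b| < d.
  move=> Aa d0; have [b [Db]] := AD a Aa _ (nbhsx_ballx a d d0).
  by rewrite -ball_normE => ab; exists b.
have [D0|[u]] := pfcard_geP cD.
  by have [b] := approx a0 1 Aa0 ltr01; rewrite D0.
exists u => [n|a d Aa d0]; first by apply: DA; exact: funS.
have [b Db ab] := approx a d Aa d0.
by have [n _ nb] := @surj _ _ _ _ u b Db; exists n; rewrite nb.
Qed.

Theorem theorem2p14 (R : realType) (X : completeNormedModType R)
    (Y : submodClosed X) :
  Daugavet_property X ->
  closed [set x : X | x \in Y] ->
  separable_set (annihilator Y) ->
  Daugavet_property (subspace_type Y).
Proof.
move=> DX _ sepY; apply/Daugavet_propertyP => e v d e0 v1 d0.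
have [u uY u_dense] : exists2 u : nat -> boundedOperator X R^o,
    forall n, annihilator Y (u n) & forall f r, annihilator Y f -> 0 < r ->
      exists n, `|f - u n| < r.
  by apply: separable_set_sequence sepY _; exists 0 => y yY.
have [x _ xe] := Hahn_Banach_norm e.
have xf_ge f : annihilator Y f -> `|e| <= `|x + f|.
  move=> fY; apply: opnorm_le => y y1.
  rewrite -xe -[x _]addr0 -(fY (val y) (valP y)).
  exact: (opnorm_unit_ball (x + f)).
(* The final estimate loses 3 r + r * `|e|, whence the denominator; the bounds
   by `|e| and 1 give e z >= 0 and the nonnegative level 1 - r. *)
pose r := Num.min d (Num.min `|e| 1) / (3 + `|e|).
have e3 : 0 < 3 + `|e| by rewrite addr_gt0.
have m0 : 0 < Num.min d (Num.min `|e| 1) by rewrite !lt_min d0 e0 ltr01.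
have r0 : 0 < r by exact: divr_gt0.
have rE : r * (3 + `|e|) = Num.min d (Num.min `|e| 1).
  by rewrite mulfVK// gt_eqF.
have rd : r * (3 + `|e|) <= d by rewrite rE ge_min lexx.
have re : r * (3 + `|e|) <= `|e| by rewrite rE !ge_min lexx orbT.
have r1 : r * (3 + `|e|) <= 1 by rewrite rE !ge_min lexx !orbT.
have [||g [g1 gv] gu] := @Daugavet_slice_sequence R X DX (val v, 1 - r)
    (fun n => x + u n) r _ _ r0.
- have -> : `|val v| = 1 by exact: v1.
  by rewrite subr_ge0 ltrBlDr ltrDl r0 andbT /=; nra.
- by move=> n; exact: lt_le_trans e0 (xf_ge _ (uY n)).
have xgf f : annihilator Y f -> `|e| + 1 - 2 * r <= `|x + g + f|.
  move=> fY; have [n fn] := u_dense f r fY r0.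
  have := gu n; have := xf_ge _ (uY n).
  have := ler_normB (x + g + f) (f - u n).
  have -> : x + g + f - (f - u n) = x + u n + g.
    by rewrite opprB (addrC (u n)) addrA addrK addrAC.
  lra.
have [|z [z1 xgz]] := restriction_norm_ge xgf (d := `|e| + 1 - 3 * r).
  by lra.
exists z => //.
have gz : (g (val z) : R) <= 1.
  by apply: le_trans (ler_norm _) (le_trans (bop_le g _) _); rewrite mulr_ile1.
have ez : (e z : R) <= `|e|.
  by apply: le_trans (ler_norm _) (le_trans (bop_le e z) _); rewrite ler_piMr.
have egz : `|e| + 1 - 3 * r < (e z : R) + (g (val z) : R) by rewrite -xe.
(* The functional g is a witness for the norm of z + e z *: v. *)
have gT : (g (val z) : R) + (e z : R) * (g (val v) : R) <= `|z + e z *: v|.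
  have -> : (g (val z) : R) + (e z : R) * (g (val v) : R) = g (val (z + e z *: v)).
    change (val (z + e z *: v)) with (val z + (e z : R) *: val v).
    by rewrite bopD bopZ.
  apply: le_trans (ler_norm _) (le_trans (bop_le g _) _).
  by rewrite ler_piMl.
have re0 : 0 <= r * `|e| by rewrite mulr_ge0// ltW.
have ez0 : 0 <= (e z : R) by lra.
have egv : (e z : R) * (1 - r) <= (e z : R) * (g (val v) : R).
  exact: ler_wpM2l.
have : r * (e z : R) <= r * `|e| by rewrite ler_wpM2l// ltW.
lra.
Qed.
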